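(* Let $N\ge 1$ and $d\ge 1$, and consider bosons on a $d$-dimensional lattice with $N$ sites per unit cell and periodic boundary conditions, with momentum-space annihilation operators $b_{n,\vec k}$ ($n=1,\dots,N$) obeying canonical bosonic commutation relations. Let $R_+,R_-\ge 0$ be integers with $R_++R_-\le N$, and for $\sigma\in\{+,-\}$ let $u_\sigma(\vec k),v_\sigma(\vec k)$ be complex $R_\sigma\times N$ matrices satisfying, for all $\vec k$ and all $\sigma,\sigma'\in\{+,-\}$, $$u_\sigma(\vec k)u_{\sigma'}^\dagger(\vec k)-v_\sigma(\vec k)v_{\sigma'}^\dagger(\vec k)=\delta_{\sigma\sigma'}\mathbb{1}_{R_\sigma},\qquad u_\sigma(\vec k)v_{\sigma'}^T(-\vec k)-v_\sigma(\vec k)u_{\sigma'}^T(-\vec k)=0,$$ and such that the gauge-invariant combinations $u_\sigma^\dagger(\vec k)u_\sigma(\vec k)$, $v_\sigma^\dagger(\vec k)v_\sigma(\vec k)$ and $u_\sigma^\dagger(\vec k)v_\sigma(\vec k)$ depend smoothly on $\vec k$. Define $A_{m,\vec k,\sigma}=\sum_{n=1}^N\big(u_{mn,\sigma}(\vec k)b_{n,\vec k}+v_{mn,\sigma}(\vec k)b^\dagger_{n,-\vec k}\big)$ and $$H=\sum_{\vec k}\Big(\sum_{m=1}^{R_+}A^\dagger_{m,\vec k,+}A_{m,\vec k,+}-\sum_{m=1}^{R_-}A^\dagger_{m,\vec k,-}A_{m,\vec k,-}\Big),$$ and define the particle-number-conserving Hamiltonian $$\tilde H=\sum_{\vec k}\sum_{m,n=1}^N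 Q_{mn}(\vec k)\,b^\dagger_{m,\vec k}b_{n,\vec k},\qquad Q(\vec k)=u_+^\dagger(\vec k)u_+(\vec k)-u_-^\dagger(\vec k)u_-(\vec k).$$ Then there exists a continuous one-parameter family of quadratic bosonic Hamiltonians $H_\epsilon$, $\epsilon\in[0,1]$, with $H_0=H$ and $H_1=\tilde H$, such that for every $\epsilon\in[0,1]$: (1) $H_\epsilon$ is short-ranged in real space; (2) $H_\epsilon$ is dynamically stable; (3) the dynamical matrix of $H_\epsilon$ has a spectral gap around $\omega=\pm1/2$.
   Context: A quadratic bosonic Hamiltonian is written (up to a constant) in Bogoliubov–de Gennes (BdG) form $\frac12\sum_{\vec k}\phi_{\vec k}^\dagger h(\vec k)\phi_{\vec k}$ with Nambu vector $\phi_{\vec k}=(b_{1,\vec k},\dots,b_{N,\vec k},b^\dagger_{1,-\vec k},\dots,b^\dagger_{N,-\vec k})^T$ and Hermitian $2N\times 2N$ BdG matrix $h(\vec k)$. Its dynamical matrix is $D(\vec k)=\tau_z h(\vec k)$, where $\tau_z=\mathrm{diag}(\mathbb{1}_N,-\mathbb{1}_N)$; the Heisenberg equations read $\dot\phi=-i\tau_z h\phi$ and the eigenvalues of $D(\vec k)$ are the normal-mode frequencies $\omega$. The Hamiltonian is dynamically stable if for every $\vec k$, $D(\vec k)$ is diagonalizable with all eigenvalues real (no positive-definiteness is required). It is short-ranged in real space if its BdG matrix $h(\vec k)$ depends smoothly on $\vec k$. ''The dynamical matrix has a spectral gap around $\omega=\pm1/2$'' means that the eigenvalues of $D(\vec k)$,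 over all $\vec k$, stay bounded away from $+1/2$ and $-1/2$. *)

(* Defs.v *)
From HB Require Import structures.
From mathcomp Require Import all_boot all_order all_algebra.
From mathcomp Require Import mxred.
From mathcomp Require Import all_classical all_reals all_analysis.
From mathcomp Require Import complex.
Set Implicit Arguments. Unset Strict Implicit. Unset Printing Implicit Defensive.
Import Order.TTheory GRing.Theory Num.Theory.
Import numFieldNormedType.Exports.
Local Open Scope classical_set_scope.
Local Open Scope ring_scope.

Section Defs.
Variable R : realType.
Local Notation C := (R[i]).

Definition adjmx m n (A : 'M[C]_(m, n)) : 'M[C]_(n, m) := (map_mx Num.conj A)^T.

Fixpoint Ck (d : nat) (n : nat) (f : 'rV[R]_d -> R) : Prop :=
  match n with
  | 0 => continuous f
  | n'.+1 => (forall x, differentiable f x) /\ forall v : 'rV[R]_d, Ck n' ('D_v f)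
  end.

Definition smooth_rfun d (f : 'rV[R]_d -> R) := forall n, Ck n f.

Definition smooth_mxfun d m n (F : 'rV[R]_d -> 'M[C]_(m, n)) :=
  forall i j, smooth_rfun (fun k => complex.Re (F k i j)) /\ smooth_rfun (fun k => complex.Im (F k i j)).

Definition periodic_mxfun d m n (F : 'rV[R]_d -> 'M[C]_(m, n)) :=
  forall (k : 'rV[R]_d) (j : 'I_d), F (k + (2 * pi) *: delta_mx 0 j) = F k.

Definition tau_z N : 'M[C]_(N + N) := block_mx 1%:M 0 0 (- 1%:M).
Definition tau_x N : 'M[C]_(N + N) := block_mx 0 1%:M 1%:M 0.

Definition dynmx N (h : 'M[C]_(N + N)) := tau_z N *m h.

Definition is_quadratic_bdg d N (h : 'rV[R]_d -> 'M[C]_(N + N)) :=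
  periodic_mxfun h /\
  forall k, adjmx (h k) = h k /\ tau_x N *m (h (- k))^T *m tau_x N = h k.

Definition short_ranged d N (h : 'rV[R]_d -> 'M[C]_(N + N)) := smooth_mxfun h.

Definition dyn_stable d N (h : 'rV[R]_d -> 'M[C]_(N + N)) :=
  forall k, diagonalizable (dynmx (h k)) /\
    forall w : C, eigenvalue (dynmx (h k)) w -> w \is Num.real.

Definition gap_half d N (h : 'rV[R]_d -> 'M[C]_(N + N)) :=
  exists delta : R, 0 < delta /\
    forall k (w : C), eigenvalue (dynmx (h k)) w ->
      ((delta%:C)%C <= `|w - 2^-1|) /\ ((delta%:C)%C <= `|w + 2^-1|).

Definition bdg_of_H d N Rp Rm
  (up vp : 'rV[R]_d -> 'M[C]_(Rp, N)) (um vm : 'rV[R]_d -> 'M[C]_(Rm, N))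
  : 'rV[R]_d -> 'M[C]_(N + N) :=
  let M k := adjmx (row_mx (up k) (vp k)) *m row_mx (up k) (vp k)
           - adjmx (row_mx (um k) (vm k)) *m row_mx (um k) (vm k) in
  fun k => M k + tau_x N *m (M (- k))^T *m tau_x N.

Definition bdg_of_Htilde d N Rp Rm
  (up : 'rV[R]_d -> 'M[C]_(Rp, N)) (um : 'rV[R]_d -> 'M[C]_(Rm, N))
  : 'rV[R]_d -> 'M[C]_(N + N) :=
  let Q k := adjmx (up k) *m up k - adjmx (um k) *m um k in
  fun k => block_mx (Q k) 0 0 (Q (- k))^T.

End Defs.

(* Main.v *)
Require Import Defs.
From HB Require Import structures.
From mathcomp Require Import all_boot all_order all_algebra.
From mathcomp Require Import mxred.
From mathcomp Require Import all_classical all_reals all_analysis.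
From mathcomp Require Import complex.
From mathcomp Require Import ring.
Set Implicit Arguments. Unset Strict Implicit. Unset Printing Implicit Defensive.
Import Order.TTheory GRing.Theory Num.Theory.
Import numFieldNormedType.Exports.
Local Open Scope classical_set_scope.
Local Open Scope ring_scope.

(** Rescale [v] by [s = 1 - eps]. Let [W] be the matrix whose rows are the mode
vectors [(u, s v)] and their particle-hole conjugates, and [S] their signature.
Then [D = (tau_z W^H) (S W)], and the product in the other order is [S (W tau_z
W^H)], where the bosonic constraints give [S (W tau_z W^H) = S' P] with [S'] a
Hermitian involution and [P = 1 + (1 - s^2) B B^H >= 1]. So the nonzero
spectrum of [D] is that of [S' P]. Pairing [y S' P = a y] with [z = y S'] gives
[z P z^H = a z S' z^H], so [a] is real and [|a| >= 1]; self-adjointness of [S'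
P] for the form [S' P S'] excludes Jordan blocks. The gap between [0] and
modulus [1] therefore persists along the whole path. *)

Lemma diagonalizable_ker_sqr (F : closedFieldType) n (A : 'M[F]_n) :
  (forall a (x : 'rV[F]_n),
     x *m (A - a%:M) *m (A - a%:M) = 0 -> x *m (A - a%:M) = 0) ->
  diagonalizable A.
Proof.
case: n => [|n] in A *.
  by move=> _; rewrite [A]thinmx0; exact: diagonalizable0.
move=> kerA.
have kerM a (B : 'M[F]_n.+1) :
    B * (A - a%:M) * (A - a%:M) = 0 -> B * (A - a%:M) = 0.
  move=> B0; apply/row_matrixP => i; rewrite row0 row_mul; apply: kerA.
  by rewrite -!row_mul -[_ *m (A - _)]/(_ * _) B0 row0.
have hX a : horner_mx A ('X - a%:P) = A - a%:M.
  by rewrite rmorphB /= horner_mx_X horner_mx_C.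
(* The left factor [B] stays arbitrary so that the induction can absorb into it the factors already
   passed. *)
have undupP s (B : 'M[F]_n.+1) :
    B * horner_mx A (\prod_(x <- s) ('X - x%:P)) = 0 ->
    B * horner_mx A (\prod_(x <- undup s) ('X - x%:P)) = 0.
  elim: s B => [|a s IHs] B //=.
  rewrite big_cons rmorphM /= hX mulrA => /IHs.
  case: ifP => [a_s | _]; last by rewrite big_cons rmorphM /= hX mulrA.
  (* Here [a] occurs again further on, so [A - a] appears twice; the factors commute, and [kerM]
     removes one copy. *)
  rewrite (big_rem a) ?mem_undup //= mulrC rmorphM /= hX.
  set P := horner_mx A _ => BP0.
  rewrite mulrA; apply: kerM; rewrite -[RHS]BP0.
  have cP : P * (A - a%:M) = (A - a%:M) * P.
    by rewrite -hX /P -!rmorphM mulrC.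
  by rewrite -(mulrA B P) {1}cP !mulrA.
apply/diagonalizableP; case: (closed_field_poly_normal (mxminpoly A)) => r.
rewrite (monicP (mxminpoly_monic A)) scale1r => rP.
exists (undup r); first exact: undup_uniq.
apply: mxminpoly_min; rewrite -[LHS]mul1r; apply: undupP.
by rewrite mul1r -rP mx_root_minpoly.
Qed.

(** * Adjoints and Hermitian forms *)

Section Adjoint.
Context {R : realType}.
Local Notation C := R[i].

Lemma adjmxK m n : cancel (@adjmx R m n) (@adjmx R n m).
Proof. by move=> A; apply/matrixP => i j; rewrite !mxE conjCK. Qed.

Lemma adjmxM m n p (A : 'M[C]_(m, n)) (B : 'M[C]_(n, p)) :
  adjmx (A *m B) = adjmx B *m adjmx A.
Proof. by rewrite /adjmx map_mxM trmx_mul. Qed.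

Lemma adjmxD m n (A B : 'M[C]_(m, n)) : adjmx (A + B) = adjmx A + adjmx B.
Proof. by rewrite /adjmx map_mxD raddfD. Qed.

Lemma adjmxN m n (A : 'M[C]_(m, n)) : adjmx (- A) = - adjmx A.
Proof. by rewrite /adjmx map_mxN raddfN. Qed.

Lemma adjmxZ m n (a : C) (A : 'M[C]_(m, n)) :
  adjmx (a *: A) = a^* *: adjmx A.
Proof. by rewrite /adjmx map_mxZ linearZ. Qed.

Lemma adjmx0 m n : adjmx (0 : 'M[C]_(m, n)) = 0.
Proof. by rewrite /adjmx map_mx0 trmx0. Qed.

Lemma adjmx_scalar n (a : C) : adjmx (a%:M : 'M[C]_n) = (a^*)%:M.
Proof. by rewrite /adjmx map_scalar_mx tr_scalar_mx. Qed.

Lemma adjmx_tr m n (A : 'M[C]_(m, n)) : adjmx A^T = (adjmx A)^T.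
Proof. by rewrite /adjmx -map_trmx. Qed.

Lemma adjmx_block m1 m2 n1 n2 (A : 'M[C]_(m1, n1)) (B : 'M[C]_(m1, n2))
    (D : 'M[C]_(m2, n1)) (E : 'M[C]_(m2, n2)) :
  adjmx (block_mx A B D E) = block_mx (adjmx A) (adjmx D) (adjmx B) (adjmx E).
Proof. by rewrite /adjmx map_block_mx tr_block_mx. Qed.

Lemma adjmx_row m n1 n2 (A : 'M[C]_(m, n1)) (B : 'M[C]_(m, n2)) :
  adjmx (row_mx A B) = col_mx (adjmx A) (adjmx B).
Proof. by rewrite /adjmx map_row_mx tr_row_mx. Qed.

Lemma adjmx_col m1 m2 n (A : 'M[C]_(m1, n)) (B : 'M[C]_(m2, n)) :
  adjmx (col_mx A B) = row_mx (adjmx A) (adjmx B).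
Proof. by rewrite /adjmx map_col_mx tr_col_mx. Qed.

Definition sqnorm n (x : 'rV[C]_n) : C := (x *m adjmx x) 0 0.

Lemma sqnormE n (x : 'rV[C]_n) : sqnorm x = \sum_i `|x 0 i| ^+ 2.
Proof. by rewrite /sqnorm mxE; apply: eq_bigr => i _; rewrite !mxE normCK. Qed.

Lemma sqnorm_ge0 n (x : 'rV[C]_n) : 0 <= sqnorm x.
Proof. by rewrite sqnormE sumr_ge0 // => i _; rewrite exprn_ge0. Qed.

Lemma sqnorm_eq0 n (x : 'rV[C]_n) : (sqnorm x == 0) = (x == 0).
Proof.
apply/eqP/eqP => [|->]; last by rewrite /sqnorm mul0mx mxE.
rewrite sqnormE => /psumr_eq0P x0; apply/rowP => i; rewrite mxE.
by apply/eqP; rewrite -normr_eq0 -sqrf_eq0 x0 // => j _; rewrite exprn_ge0.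
Qed.

Definition qform n (M : 'M[C]_n) (x : 'rV[C]_n) : C := (x *m M *m adjmx x) 0 0.

(* If [S] is a Hermitian involution, then [z] splits into the
   orthogonal parts [z (1 + S) / 2] and [z (1 - S) / 2]. *)
Lemma qform_involution_norm n (S : 'M[C]_n) (z : 'rV[C]_n) :
  adjmx S = S -> S *m S = 1%:M ->
  qform S z \is Num.real /\ `|qform S z| <= sqnorm z.
Proof.
move=> hS S2.
have sqD b : b^* = b -> b * b = 1 ->
    sqnorm (z + b *: (z *m S)) = (sqnorm z + b * qform S z) *+ 2.
  move=> bJ b2; rewrite /sqnorm /qform adjmxD adjmxZ bJ adjmxM hS.
  rewrite mulmxDl !mulmxDr -!scalemxAl -!scalemxAr scalerA b2 scale1r.
  rewrite !mulmxA -[z *m S *m S]mulmxA S2 mulmx1.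
  by rewrite !mxE mulr2n; ring.
have q_le b : b^* = b -> b * b = 1 -> 0 <= sqnorm z + b * qform S z.
  by move=> bJ b2; rewrite -(pmulrn_lge0 _ (isT : (0 < 2)%N)) -sqD // sqnorm_ge0.
have le1 : - sqnorm z <= qform S z.
  have := q_le 1; rewrite conjC1 !mul1r => /(_ erefl erefl).
  by rewrite -lerBlDl sub0r.
have le2 : qform S z <= sqnorm z.
  have := q_le (-1); rewrite conjCN1 mulrNN mulr1 mulN1r.
  by move=> /(_ erefl erefl); rewrite subr_ge0.
have qR : qform S z \is Num.real.
  by rewrite (ler_real le2) realE sqnorm_ge0.
by split=> //; rewrite real_ler_norml // le1.
Qed.

(** * Spectrum of [S P] for a Hermitian involution [S] and [P >= 1] *)

Section Pseudohermitian.
Variables (m : nat) (S P : 'M[C]_m).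
Hypotheses (adjS : adjmx S = S) (S2 : S *m S = 1%:M).
Hypotheses (adjP : adjmx P = P) (P_ge1 : forall z, sqnorm z <= qform P z).

Lemma mulmx_involution_eq0 (y : 'rV[C]_m) : (y *m S == 0) = (y == 0).
Proof.
apply/eqP/eqP => [y0 | ->]; last by rewrite mul0mx.
by rewrite -[y]mulmx1 -S2 mulmxA y0 mul0mx.
Qed.

(** The eigenvalue is the ratio of [z P z^H], which is at least the squared norm of [z], to the real
    number [z S z^H], which is at most that norm in modulus. *)
Lemma pseudohermitian_eigen a (y : 'rV[C]_m) :
  y *m (S *m P) = a *: y -> y != 0 -> a \is Num.real /\ 1 <= `|a|.
Proof.
move=> yE y0; pose z := y *m S.
have z_gt0 : 0 < sqnorm z.
  by rewrite lt_def sqnorm_ge0 sqnorm_eq0 mulmx_involution_eq0 y0.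
have pE : qform P z = a * qform S z.
  rewrite /qform /z -[y *m S *m P]mulmxA yE -[y *m S *m S]mulmxA S2 mulmx1.
  by rewrite -scalemxAl mxE.
have [qR q_le] := qform_involution_norm z adjS S2.
have p_ge : sqnorm z <= a * qform S z by rewrite -pE.
have p_gt0 := lt_le_trans z_gt0 p_ge.
have q0 : qform S z != 0 by apply: contraTneq p_gt0 => ->; rewrite mulr0 ltxx.
split; first by rewrite -(mulfK q0 a) realM ?realV ?(gtr0_real p_gt0).
have /ger0_norm pN := ltW p_gt0.
rewrite -(ler_pM2r (_ : 0 < `|qform S z|)) ?normr_gt0 // mul1r.
by rewrite -normrM pN (le_trans q_le).
Qed.

(* [S P] is self-adjoint for the positive definite form given by [S P S]. *)
Lemma pseudohermitian_ker_sqr a (y : 'rV[C]_m) :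
  y *m (S *m P - a%:M) *m (S *m P - a%:M) = 0 -> y *m (S *m P - a%:M) = 0.
Proof.
set M := S *m P; set z := y *m (M - a%:M) => z0.
apply/eqP/negPn/negP => z_neq0.
have zM : z *m M = a *: z.
  by apply/eqP; rewrite -subr_eq0 -mul_mx_scalar -mulmxBr z0.
have [/CrealP aR _] := pseudohermitian_eigen zM z_neq0.
have adjM : adjmx (M - a%:M) = P *m S - a%:M.
  by rewrite adjmxD adjmxN adjmx_scalar /M adjmxM adjS adjP aR.
have KM : (S *m P *m S) *m (P *m S - a%:M) = (M - a%:M) *m (S *m P *m S).
  rewrite mulmxBr mulmxBl mul_mx_scalar mul_scalar_mx /M.
  by rewrite !mulmxA.
suff : z == 0 by apply/negP.
rewrite -mulmx_involution_eq0 -sqnorm_eq0 eq_le sqnorm_ge0 andbT.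
apply: le_trans (P_ge1 _) _.
(* Moving the factor [M - a] of the second [z] across the form [S P S] produces [z (M - a)], which
   is zero. *)
rewrite /qform adjmxM adjS !mulmxA -(mulmxA z) -(mulmxA z).
rewrite {2}/z adjmxM adjM mulmxA -(mulmxA z (S *m P *m S)) KM.
by rewrite mulmxA z0 !mul0mx mxE.
Qed.

(** The map [x -> x X] intertwines [X Y] with [Y X = S P]. It is injective on eigenvectors with
    nonzero eigenvalue, so only the eigenvalue [0] needs a separate argument. *)
Lemma pseudohermitian_product_spectrum n (X : 'M[C]_(n, m)) (Y : 'M[C]_(m, n)) :
  Y *m X = S *m P ->
  diagonalizable (X *m Y) /\
  forall w, eigenvalue (X *m Y) w -> w \is Num.real /\ (w = 0 \/ 1 <= `|w|).
Proof.
move=> YX; split=> [|w /eigenvalueP[x xE x0]]; last first.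
  have [->|w0] := eqVneq w 0; first by split; [exact: real0 | left].
  have /pseudohermitian_eigen [] : (x *m X) *m (S *m P) = w *: (x *m X).
  - by rewrite -YX !mulmxA -(mulmxA x X Y) xE -scalemxAl.
  - apply: contraNneq x0 => xX0; move: xE; rewrite mulmxA xX0 mul0mx.
    by move/esym/eqP; rewrite scaler_eq0 (negPf w0).
  by split=> //; right.
(* An eigenvalue [0] of [S P] would contradict the bound [1 <= |a|]. *)
have SP_inj (y : 'rV[C]_m) : y *m (S *m P) = 0 -> y = 0.
  move=> y0; apply/eqP/negPn/negP => yn0.
  have [] := @pseudohermitian_eigen 0 y _ yn0; first by rewrite scale0r.
  by rewrite normr0 ler10.
apply: diagonalizable_ker_sqr => a x; set y := x *m (X *m Y - a%:M) => y0.
have shift (t : 'rV[C]_n) :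
    t *m (X *m Y - a%:M) *m X = (t *m X) *m (S *m P - a%:M).
  by rewrite mulmxBr mulmxBl mulmxBr -YX !mul_mx_scalar -scalemxAl !mulmxA.
have yX0 : y *m X = 0.
  by rewrite /y shift; apply: pseudohermitian_ker_sqr; rewrite -!shift y0 mul0mx.
(* Since [y X = 0], the hypothesis on [y] reduces to [a y = 0]. If [a = 0], then [y X = x X S P], so
   injectivity gives [x X = 0] and hence [y = x X Y = 0]. *)
move: y0; rewrite mulmxBr mulmxA yX0 mul0mx sub0r mul_mx_scalar.
move/eqP; rewrite oppr_eq0 scaler_eq0 => /orP[/eqP a0|/eqP//].
move: yX0; rewrite shift a0 raddf0 subr0 => /SP_inj xX0.
by rewrite /y a0 raddf0 subr0 mulmxA xX0 mul0mx.
Qed.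

End Pseudohermitian.
End Adjoint.

(** * Closure properties of [Ck] functions *)

Section Smooth.
Context {R : realType} {d : nat}.
Implicit Types f g : 'rV[R]_d -> R.

Lemma CkD n f g : Ck n f -> Ck n g -> Ck n (fun k => f k + g k).
Proof.
elim: n f g => [|n IHn] f g /=.
  by move=> cf cg x; exact: (cvgD (cf x) (cg x)).
move=> [df Df] [dg Dg]; split=> [x|v]; first exact: differentiableD.
have -> : 'D_v (fun k => f k + g k) = fun k => 'D_v f k + 'D_v g k.
  by apply/funext => x; rewrite -deriveD //; exact: diff_derivable.
exact: IHn.
Qed.

Lemma CkZ n (a : R) f : Ck n f -> Ck n (fun k => a * f k).
Proof.
elim: n f => [|n IHn] f /=.
  by move=> cf x; exact: (cvgM (cvg_cst a) (cf x)).
move=> [df Df]; split=> [x|v]; first exact: (differentiableZ a (df x)).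
have -> : 'D_v (fun k => a * f k) = fun k => a * 'D_v f k.
  by apply/funext => x; rewrite -[RHS]deriveZ //; exact: diff_derivable.
exact: IHn.
Qed.

Lemma derive_compN f v : 'D_v (fun k => f (- k)) = fun k => 'D_(- v) f (- k).
Proof.
(* The difference quotients on the two sides are the same function, so their [lim] agree whether or
   not they converge. *)
apply/funext => x; apply: (congr1 (fun g : R -> R => lim (g @ 0^'))).
by apply/funext => h /=; rewrite opprD scalerN.
Qed.

Lemma Ck_compN n f : Ck n f -> Ck n (fun k => f (- k)).
Proof.
elim: n f => [|n IHn] f /=.
  have cN : continuous (-%R : 'rV[R]_d -> 'rV[R]_d) by exact: opp_continuous.
  by move=> cf x; exact: (continuous_comp (cN x) (cf (- x))).
move=> [df Df]; split=> [x|v]; last first.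
  by rewrite derive_compN; exact: (IHn _ (Df (- v))).
have dN : differentiable (-%R : 'rV[R]_d -> 'rV[R]_d) x by exact: differentiableN.
exact: (differentiable_comp dN (df _)).
Qed.

End Smooth.

(** * Regularity of complex matrix functions, entry by entry *)

Section Entrywise.
Context {R : realType} {T : Type}.
Local Notation C := R[i].

(** Leaving the class [K] abstract lets the same closure lemmas serve smoothness in [k] and joint
    continuity in [(eps, k)]. *)
Definition entrywise (K : (T -> R) -> Prop) m n (F : T -> 'M[C]_(m, n)) :=
  forall i j, K (fun t => complex.Re (F t i j)) /\
              K (fun t => complex.Im (F t i j)).

Variable K : (T -> R) -> Prop.
Hypothesis KD : forall f g, K f -> K g -> K (fun t => f t + g t).
Hypothesis KN : forall f, K f -> K (fun t => - f t).

Lemma entrywiseD m n (F G : T -> 'M[C]_(m, n)) :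
  entrywise K F -> entrywise K G -> entrywise K (fun t => F t + G t).
Proof.
move=> KF KG i j; have [Fr Fi] := KF i j; have [Gr Gi] := KG i j.
split; [have := KD Fr Gr | have := KD Fi Gi]; congr (K _); apply/funext => t.
- by rewrite mxE raddfD.
- by rewrite mxE raddfD.
Qed.

Lemma entrywiseN m n (F : T -> 'M[C]_(m, n)) :
  entrywise K F -> entrywise K (fun t => - F t).
Proof.
move=> KF i j; have [/KN Fr /KN Fi] := KF i j.
split; [move: Fr | move: Fi]; congr (K _); apply/funext => t.
- by rewrite mxE raddfN.
- by rewrite mxE raddfN.
Qed.

Lemma entrywise_tr m n (F : T -> 'M[C]_(m, n)) :
  entrywise K F -> entrywise K (fun t => (F t)^T).
Proof.
move=> KF i j; have [Fr Fi] := KF j i.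
by split; [move: Fr | move: Fi]; congr (K _); apply/funext => t; rewrite mxE.
Qed.

Lemma entrywise_adj m n (F : T -> 'M[C]_(m, n)) :
  entrywise K F -> entrywise K (fun t => adjmx (F t)).
Proof.
move=> KF i j; have [Fr /KN Fi] := KF j i.
split; [move: Fr | move: Fi]; congr (K _); apply/funext => t;
  by rewrite !mxE; case: (F t j i).
Qed.

(** Closure under multiplication by the single function [s] covers both uses: a constant for
    smoothness, [1 - eps] for joint continuity. *)
Lemma entrywiseZ (s : T -> R) m n (F : T -> 'M[C]_(m, n)) :
  (forall f, K f -> K (fun t => s t * f t)) ->
  entrywise K F -> entrywise K (fun t => (s t)%:C%C *: F t).
Proof.
move=> Ks KF i j; have [/Ks Fr /Ks Fi] := KF i j.
split; [move: Fr | move: Fi]; congr (K _); apply/funext => t;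
  by rewrite mxE; case: (F t i j) => a b /=; rewrite mul0r ?subr0 ?addr0.
Qed.

Lemma entrywise_block m1 m2 n1 n2 (A : T -> 'M[C]_(m1, n1))
    (B : T -> 'M[C]_(m1, n2)) (D : T -> 'M[C]_(m2, n1))
    (E : T -> 'M[C]_(m2, n2)) :
  entrywise K A -> entrywise K B -> entrywise K D -> entrywise K E ->
  entrywise K (fun t => block_mx (A t) (B t) (D t) (E t)).
Proof.
move=> KA KB KD' KE i j.
pose good (f : T -> C) :=
  K (fun t => complex.Re (f t)) /\ K (fun t => complex.Im (f t)).
rewrite -/(good (fun t => block_mx (A t) (B t) (D t) (E t) i j)).
case: (split_ordP i) => i' ->; case: (split_ordP j) => j' ->.
- by under eq_fun do rewrite block_mxEul; exact: KA.
- by under eq_fun do rewrite block_mxEur; exact: KB.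
- by under eq_fun do rewrite block_mxEdl; exact: KD'.
- by under eq_fun do rewrite block_mxEdr; exact: KE.
Qed.

End Entrywise.

(* Otherwise unification unfolds [adjmx A] to a transpose and loops in [adjmx_tr]. *)
Opaque adjmx.

(** * Block-matrix identities for the factorization *)

Lemma block_swap_conj (K : pzRingType) N (A B D E : 'M[K]_N) :
  block_mx 0 1%:M 1%:M 0 *m block_mx A B D E *m block_mx 0 1%:M 1%:M 0 =
  block_mx E D B A.
Proof.
by rewrite !mulmx_block !mul0mx !mulmx0 !mul1mx !mulmx1 !add0r !addr0.
Qed.

Lemma trmxD (V : nmodType) m n (A B : 'M[V]_(m, n)) : (A + B)^T = A^T + B^T.
Proof. exact: raddfD. Qed.

Lemma trmxZ (K : pzRingType) m n (a : K) (A : 'M[K]_(m, n)) :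
  (a *: A)^T = a *: A^T.
Proof. exact: linearZ. Qed.

Lemma mul_block_scaled (K : comPzRingType) m1 m2 n (c : K)
    (a d : 'M[K]_(m1, n)) (b e : 'M[K]_(m1, n))
    (p q r t : 'M[K]_(n, m2)) :
  block_mx a (c *: b) (- (c *: d)) (- e) *m block_mx p (c *: q) (c *: r) t =
  block_mx (a *m p + c *: (c *: (b *m r))) (c *: (a *m q + b *m t))
    (- (c *: (d *m p + e *m r))) (- (c *: (c *: (d *m q)) + e *m t)).
Proof.
rewrite mulmx_block !mulNmx -!scalemxAl -!scalemxAr.
by rewrite -!opprD -!scalerDr.
Qed.

Lemma mul_sign_block (K : pzRingType) m1 m2 n1 n2 (A : 'M[K]_(m1, n1))
    (B : 'M[K]_(m1, n2)) (D : 'M[K]_(m2, n1)) (E : 'M[K]_(m2, n2)) :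
  block_mx 1%:M 0 0 (- 1%:M) *m block_mx A B D E = block_mx A B (- D) (- E).
Proof. by rewrite mulmx_block !mul0mx mulNmx !mul1mx mulNmx mul1mx !addr0 !add0r. Qed.

(** In this order of the factors, [c] is only an overall factor off the diagonal, so constraints
    that kill those blocks at [c = 1] kill them for every [c]. *)
Lemma mul_block_scaled_gram (K : comPzRingType) m n (c : K) (J : 'M[K]_m)
    (u v w x : 'M[K]_(m, n)) (a b d e : 'M[K]_(n, m)) :
  block_mx (J *m u) (c *: (J *m v)) (c *: (J *m w)) (J *m x) *m
    block_mx a (c *: b) (- (c *: d)) (- e) =
  block_mx (J *m (u *m a - (c * c) *: (v *m d))) (c *: (J *m (u *m b - v *m e)))
    (c *: (J *m (w *m a - x *m d))) (- (J *m (x *m e - (c * c) *: (w *m b)))).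
Proof.
rewrite mulmx_block !mulmxN -!scalemxAl -!scalemxAr -!mulmxA !mulmxBr.
by rewrite -!scalemxAr !scalerBr !scalerA opprB.
Qed.

(** * The BdG matrix along the path and its spectrum *)

Section BdG.
Context {R : realType}.
Local Notation C := R[i].

(* The BdG matrix at [k] with blocks built from
   [Q = u^H J u], [T = v^H J v], [Z = u^H J v], where [J] is the signature
   of the two species; primes denote the values at [- k], and [v] is rescaled by [s]. *)
Definition bdg_block N (s : R) (Q Q' T T' Z Z' : 'M[C]_N) : 'M[C]_(N + N) :=
  block_mx (Q + s%:C%C *: (s%:C%C *: T'^T)) (s%:C%C *: (Z + Z'^T))
           (s%:C%C *: (adjmx Z + (adjmx Z')^T)) (s%:C%C *: (s%:C%C *: T) + Q'^T).

(** Regularity is assumed only for such gauge-invariant products, not for [u] and [v], so the BdG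
    matrix is expressed through them. *)
Definition graded_gram Rp Rm N (ap bp : 'M[C]_(Rp, N)) (am bm : 'M[C]_(Rm, N)) :=
  adjmx ap *m bp - adjmx am *m bm.

Definition signature Rp Rm : 'M[C]_(Rp + Rm) := block_mx 1%:M 0 0 (- 1%:M).

Lemma graded_gramE Rp Rm N (ap bp : 'M[C]_(Rp, N)) (am bm : 'M[C]_(Rm, N)) :
  graded_gram ap bp am bm =
  adjmx (col_mx ap am) *m signature Rp Rm *m col_mx bp bm.
Proof.
rewrite adjmx_col mul_row_block mul_row_col !mulmx0 !mulmx1 addr0 add0r.
by rewrite mulmxN mulmx1 mulNmx.
Qed.

Lemma adjmx_graded_gram Rp Rm N (ap bp : 'M[C]_(Rp, N)) (am bm : 'M[C]_(Rm, N)) :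
  adjmx (graded_gram ap bp am bm) = graded_gram bp ap bm am.
Proof. by rewrite adjmxD adjmxN !adjmxM !adjmxK. Qed.

Lemma adjmx_signature Rp Rm : adjmx (signature Rp Rm) = signature Rp Rm.
Proof. by rewrite adjmx_block adjmxN !adjmx0 !adjmx_scalar conjC1. Qed.

Lemma signature_sqr Rp Rm : signature Rp Rm *m signature Rp Rm = 1%:M.
Proof.
rewrite mulmx_block !mulmx0 !mul0mx !mul1mx mulmxN mulNmx mulmx1 opprK !addr0.
by rewrite add0r -scalar_mx_block.
Qed.

Lemma tr_signature Rp Rm : (signature Rp Rm)^T = signature Rp Rm.
Proof. by rewrite tr_block_mx !trmx0 linearN /= !trmx1. Qed.

Lemma conjC_real (s : R) : (s%:C%C : C)^* = s%:C%C.
Proof. exact: conjc_real. Qed.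

Lemma tau_x_conj_tr N (A B D E : 'M[C]_N) :
  tau_x R N *m (block_mx A B D E)^T *m tau_x R N = block_mx E^T B^T D^T A^T.
Proof.
by rewrite tr_block_mx block_swap_conj.
Qed.

Lemma add_particle_hole_block N s (Q Q' T T' Z Z' : 'M[C]_N) :
  block_mx Q (s%:C%C *: Z) (s%:C%C *: adjmx Z) (s%:C%C *: (s%:C%C *: T)) +
  tau_x R N *m (block_mx Q' (s%:C%C *: Z') (s%:C%C *: adjmx Z')
                         (s%:C%C *: (s%:C%C *: T')))^T *m tau_x R N =
  bdg_block s Q Q' T T' Z Z'.
Proof.
rewrite tau_x_conj_tr add_block_mx /bdg_block.
move: (s%:C%C) (adjmx Z) (adjmx Z') => c Y Y'.
by rewrite !trmxZ !scalerDr.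
Qed.

(** Identifies the block form with the Hamiltonian of the rescaled modes; [s = 1] gives the initial
    endpoint. *)
Lemma bdg_of_HE d N Rp Rm (s : R) (up vp : 'rV[R]_d -> 'M[C]_(Rp, N))
    (um vm : 'rV[R]_d -> 'M[C]_(Rm, N)) (k : 'rV[R]_d) :
  let Q k := graded_gram (up k) (up k) (um k) (um k) in
  let T k := graded_gram (vp k) (vp k) (vm k) (vm k) in
  let Z k := graded_gram (up k) (vp k) (um k) (vm k) in
  bdg_of_H up (fun k => s%:C%C *: vp k) um (fun k => s%:C%C *: vm k) k =
  bdg_block s (Q k) (Q (- k)) (T k) (T (- k)) (Z k) (Z (- k)).
Proof.
move=> Q T Z; set c := s%:C%C.
have ME (x : 'rV[R]_d) : adjmx (row_mx (up x) (c *: vp x)) *m row_mx (up x) (c *: vp x)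
    - adjmx (row_mx (um x) (c *: vm x)) *m row_mx (um x) (c *: vm x)
    = block_mx (Q x) (c *: Z x) (c *: adjmx (Z x)) (c *: (c *: T x)).
  rewrite !adjmx_row !mul_col_row opp_block_mx add_block_mx.
  rewrite !adjmxZ conjC_real -!scalemxAl -!scalemxAr -!scalerBr.
  by rewrite adjmx_graded_gram.
have -> : bdg_of_H up (fun k => c *: vp k) um (fun k => c *: vm k) k =
    block_mx (Q k) (c *: Z k) (c *: adjmx (Z k)) (c *: (c *: T k)) +
    tau_x R N *m (block_mx (Q (- k)) (c *: Z (- k)) (c *: adjmx (Z (- k)))
      (c *: (c *: T (- k))))^T *m tau_x R N.
  by rewrite -!ME.
exact: add_particle_hole_block.
Qed.

Lemma bdg_block_hermitian N s (Q Q' T T' Z Z' : 'M[C]_N) :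
  adjmx Q = Q -> adjmx Q' = Q' -> adjmx T = T -> adjmx T' = T' ->
  adjmx (bdg_block s Q Q' T T' Z Z') = bdg_block s Q Q' T T' Z Z'.
Proof.
move=> hQ hQ' hT hT'; rewrite adjmx_block !adjmxD !adjmxZ !conjC_real.
by rewrite !adjmxD (adjmx_tr T') (adjmx_tr Q') (adjmx_tr Z') (adjmx_tr (adjmx Z'))
  !adjmxK hQ hQ' hT hT'.
Qed.

Lemma bdg_block_particle_hole N s (Q Q' T T' Z Z' : 'M[C]_N) :
  tau_x R N *m (bdg_block s Q' Q T' T Z' Z)^T *m tau_x R N =
  bdg_block s Q Q' T T' Z Z'.
Proof.
rewrite tau_x_conj_tr !trmxD !trmxZ !trmxD.
rewrite (trmxK Q) (trmxK T) (trmxK Z) (trmxK (adjmx Z)).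
by rewrite (addrC (_ *: (_ *: T'^T)) Q) (addrC Z'^T Z) (addrC (adjmx Z')^T)
  (addrC Q'^T).
Qed.

Lemma bdg_block_spectrum Rp Rm N (s : R)
    (up vp up' vp' : 'M[C]_(Rp, N)) (um vm um' vm' : 'M[C]_(Rm, N)) :
  let u := col_mx up um in let v := col_mx vp vm in
  let u' := col_mx up' um' in let v' := col_mx vp' vm' in
  u *m adjmx u - v *m adjmx v = 1%:M ->
  u' *m adjmx u' - v' *m adjmx v' = 1%:M ->
  u *m v'^T - v *m u'^T = 0 ->
  0 <= s <= 1 ->
  let D := dynmx (bdg_block s
    (graded_gram up up um um) (graded_gram up' up' um' um')
    (graded_gram vp vp vm vm) (graded_gram vp' vp' vm' vm')
    (graded_gram up vp um vm) (graded_gram up' vp' um' vm')) in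
  diagonalizable D /\
  forall w, eigenvalue D w -> w \is Num.real /\ (w = 0 \/ 1 <= `|w|).
Proof.
move=> u v u' v' uu uu' uv /andP[s0 s1] D.
set c := s%:C%C; set J := signature Rp Rm.
pose vb := (adjmx v')^T; pose ub := (adjmx u')^T.
(* [X] is [tau_z W^H] and [Y] is [diag(J, J) W]. The [S] below is the [S'] of the overview; its sign
   flip reflects the negative norm of the particle-hole conjugates. *)
pose X : 'M[C]_(N + N, (Rp + Rm) + (Rp + Rm)) :=
  block_mx (adjmx u) (c *: v'^T) (- (c *: adjmx v)) (- u'^T).
pose Y : 'M[C]_((Rp + Rm) + (Rp + Rm), N + N) :=
  block_mx (J *m u) (c *: (J *m v)) (c *: (J *m vb)) (J *m ub).
pose S := block_mx J 0 0 (- J).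
pose B := block_mx v 0 0 vb.
pose P : 'M[C]_((Rp + Rm) + (Rp + Rm)) := 1%:M + (1 - c * c) *: (B *m adjmx B).
(* The range of [s] enters here: it makes [P - 1] positive semidefinite. *)
have t_ge0 : 0 <= 1 - c * c.
  by rewrite subr_ge0 /c -rmorphM -[1]/(1%:C)%C lecR mulr_ile1.
have DE : D = X *m Y.
  rewrite /D /dynmx !graded_gramE -/u -/v -/u' -/v' -/J.
  have trJ (a b : 'M[C]_(Rp + Rm, N)) :
      (adjmx a *m J *m b)^T = b^T *m (J *m (adjmx a)^T).
    by rewrite !trmx_mul tr_signature.
  have adJ (a b : 'M[C]_(Rp + Rm, N)) :
      adjmx (adjmx a *m J *m b) = adjmx b *m J *m a.
    by rewrite !adjmxM adjmxK adjmx_signature mulmxA.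
  rewrite /bdg_block (adJ u v) (adJ u' v') !trJ -!(mulmxA _ J).
  by rewrite mul_sign_block mul_block_scaled.
have YX : Y *m X = S *m P.
  rewrite mul_block_scaled_gram uv.
  (* This is the adjoint of [uv]; [ubE] below is the transposed normalization at [- k]. *)
  have vu0 : vb *m adjmx u - ub *m adjmx v = 0.
    rewrite -(adjmx0 _ (Rp + Rm)) -uv adjmxD adjmxN !adjmxM.
    by rewrite (adjmx_tr v') (adjmx_tr u').
  (* Substitution turns [u u^H - c^2 v v^H] into [1 + (1 - c^2) v v^H], a diagonal block of [P]. *)
  have uuE : u *m adjmx u = 1%:M + v *m adjmx v by rewrite -uu subrK.
  have ubE : ub *m u'^T = 1%:M + vb *m v'^T.
    by rewrite -!trmx_mul -trmx1 -trmxD -uu' subrK.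
  have BE : B *m adjmx B = block_mx (v *m adjmx v) 0 0 (vb *m v'^T).
    rewrite adjmx_block !adjmx0 mulmx_block !mulmx0 !mul0mx !addr0 !add0r.
    by rewrite /vb (adjmx_tr (adjmx v')) adjmxK.
  have comb (G : 'M[C]_(Rp + Rm)) :
      1%:M + G - (c * c) *: G = 1%:M + (1 - c * c) *: G.
    by rewrite scalerBl scale1r addrA.
  rewrite vu0 uuE ubE !comb /P BE scale_block_mx !scaler0 mulmx0 scaler0.
  rewrite (@scalar_mx_block _ (Rp + Rm) (Rp + Rm) 1) add_block_mx !addr0 mulmx_block.
  by rewrite !mul0mx !mulmx0 !addr0 !add0r mulNmx.
rewrite DE; apply: (pseudohermitian_product_spectrum _ _ _ _ YX).
- by rewrite adjmx_block adjmxN !adjmx0 adjmx_signature.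
- rewrite mulmx_block !mulmx0 !mul0mx mulNmx mulmxN opprK signature_sqr.
  by rewrite !addr0 add0r -scalar_mx_block.
- rewrite adjmxD adjmxZ adjmxM adjmxK adjmx_scalar conjC1.
  by rewrite (CrealP (ger0_real t_ge0)).
- move=> z; rewrite /qform mulmxDr mulmx1 mulmxDl mxE lerDl.
  rewrite -scalemxAr -scalemxAl mxE mulr_ge0 //.
  by rewrite mulmxA -(mulmxA (z *m B)) -adjmxM; exact: sqnorm_ge0.
Qed.

End BdG.

(** * Regularity, periodicity and the gap, then the path itself *)

Section Assembly.
Context {R : realType}.
Local Notation C := R[i].

Lemma entrywise_bdg_block (T : Type) (K : (T -> R) -> Prop) N (s : T -> R)
    (Q Q' V V' Z Z' : T -> 'M[C]_N) :
  (forall f g, K f -> K g -> K (fun t => f t + g t)) ->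
  (forall f, K f -> K (fun t => - f t)) ->
  (forall f, K f -> K (fun t => s t * f t)) ->
  entrywise K Q -> entrywise K Q' -> entrywise K V -> entrywise K V' ->
  entrywise K Z -> entrywise K Z' ->
  entrywise K (fun t => bdg_block (s t) (Q t) (Q' t) (V t) (V' t) (Z t) (Z' t)).
Proof.
move=> KD KN Ks KQ KQ' KV KV' KZ KZ'.
apply: entrywise_block.
- apply: entrywiseD => //; apply: entrywiseZ => //; apply: entrywiseZ => //.
  exact: entrywise_tr.
- apply: entrywiseZ => //; apply: entrywiseD => //; exact: entrywise_tr.
- apply: entrywiseZ => //; apply: entrywiseD => //; first exact: entrywise_adj.
  by apply: entrywise_tr; exact: entrywise_adj.
- apply: entrywiseD => //; last exact: entrywise_tr.
  by apply: entrywiseZ => //; apply: entrywiseZ.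
Qed.

Lemma smooth_rfunD d (f g : 'rV[R]_d -> R) :
  smooth_rfun f -> smooth_rfun g -> smooth_rfun (fun k => f k + g k).
Proof. by move=> sf sg n; apply: CkD. Qed.

Lemma smooth_rfunZ d (a : R) (f : 'rV[R]_d -> R) :
  smooth_rfun f -> smooth_rfun (fun k => a * f k).
Proof. by move=> sf n; apply: CkZ. Qed.

Lemma smooth_rfunN d (f : 'rV[R]_d -> R) :
  smooth_rfun f -> smooth_rfun (fun k => - f k).
Proof.
by move/(smooth_rfunZ (-1)); congr smooth_rfun; apply/funext => k; rewrite mulN1r.
Qed.

Lemma smooth_mxfunB d m n (F G : 'rV[R]_d -> 'M[C]_(m, n)) :
  smooth_mxfun F -> smooth_mxfun G -> smooth_mxfun (fun k => F k - G k).
Proof.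
move=> sF sG; apply: (entrywiseD (@smooth_rfunD d)) => //.
exact: (entrywiseN (@smooth_rfunN d)).
Qed.

Lemma smooth_mxfun_compN d m n (F : 'rV[R]_d -> 'M[C]_(m, n)) :
  smooth_mxfun F -> smooth_mxfun (fun k => F (- k)).
Proof.
by move=> sF i j; have [sr si] := sF i j; split=> l;
  [exact: (Ck_compN (sr l)) | exact: (Ck_compN (si l))].
Qed.

Lemma smooth_mxfun_continuous (T : topologicalType) d m n
    (F : 'rV[R]_d -> 'M[C]_(m, n)) (q : T -> 'rV[R]_d) :
  smooth_mxfun F -> continuous q ->
  entrywise (fun f : T -> R => continuous f) (fun t => F (q t)).
Proof.
move=> sF cq i j; have [/(_ 0%N) sr /(_ 0%N) si] := sF i j.
by split=> t; [exact: (continuous_comp (cq t) (sr _))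
  | exact: (continuous_comp (cq t) (si _))].
Qed.

Lemma periodic_mxfunB d m n (F G : 'rV[R]_d -> 'M[C]_(m, n)) :
  periodic_mxfun F -> periodic_mxfun G -> periodic_mxfun (fun k => F k - G k).
Proof. by move=> pF pG k j; rewrite pF pG. Qed.

Lemma periodic_mxfun_opp d m n (F : 'rV[R]_d -> 'M[C]_(m, n)) k j :
  periodic_mxfun F -> F (- (k + (2 * pi) *: delta_mx 0 j)) = F (- k).
Proof. by move=> pF; rewrite -[LHS](pF _ j) opprD subrK. Qed.

Lemma bdg_block0 N (Q Q' V V' Z Z' : 'M[C]_N) :
  bdg_block 0 Q Q' V V' Z Z' = block_mx Q 0 0 Q'^T.
Proof. by rewrite /bdg_block raddf0 !scale0r addr0 add0r. Qed.

(** The point [0] is at distance exactly [1/2] from [b]; outside the open unit disc the reverse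
    triangle inequality leaves [1 - 1/2]. *)
Lemma gap_half_norm (w b : C) : `|b| = 2^-1 -> w = 0 \/ 1 <= `|w| ->
  ((2^-1 : R)%:C)%C <= `|w - b|.
Proof.
rewrite fmorphV rmorph_nat => bE [->|w1]; first by rewrite sub0r normrN bE.
apply: le_trans (lerB_dist _ _); rewrite bE lerBrDr.
by have := splitr (1 : C); rewrite div1r => <-.
Qed.

End Assembly.

Theorem theorem1 (R : realType) (N d Rp Rm : nat)
  (up vp : 'rV[R]_d -> 'M[R[i]]_(Rp, N))
  (um vm : 'rV[R]_d -> 'M[R[i]]_(Rm, N)) :
  (1 <= N)%N -> (1 <= d)%N -> (Rp + Rm <= N)%N ->
  (* bosonic (symplectic) constraints, for all k and all sigma, sigma' *)
  (forall k, up k *m adjmx (up k) - vp k *m adjmx (vp k) = 1%:M) ->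
  (forall k, um k *m adjmx (um k) - vm k *m adjmx (vm k) = 1%:M) ->
  (forall k, up k *m adjmx (um k) - vp k *m adjmx (vm k) = 0) ->
  (forall k, um k *m adjmx (up k) - vm k *m adjmx (vp k) = 0) ->
  (forall k, up k *m (vp (- k))^T - vp k *m (up (- k))^T = 0) ->
  (forall k, um k *m (vm (- k))^T - vm k *m (um (- k))^T = 0) ->
  (forall k, up k *m (vm (- k))^T - vp k *m (um (- k))^T = 0) ->
  (forall k, um k *m (vp (- k))^T - vm k *m (up (- k))^T = 0) ->
  (* gauge-invariant combinations are smooth functions on the Brillouin zone *)
  smooth_mxfun (fun k => adjmx (up k) *m up k) ->
  smooth_mxfun (fun k => adjmx (vp k) *m vp k) ->
  smooth_mxfun (fun k => adjmx (up k) *m vp k) ->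
  smooth_mxfun (fun k => adjmx (um k) *m um k) ->
  smooth_mxfun (fun k => adjmx (vm k) *m vm k) ->
  smooth_mxfun (fun k => adjmx (um k) *m vm k) ->
  periodic_mxfun (fun k => adjmx (up k) *m up k) ->
  periodic_mxfun (fun k => adjmx (vp k) *m vp k) ->
  periodic_mxfun (fun k => adjmx (up k) *m vp k) ->
  periodic_mxfun (fun k => adjmx (um k) *m um k) ->
  periodic_mxfun (fun k => adjmx (vm k) *m vm k) ->
  periodic_mxfun (fun k => adjmx (um k) *m vm k) ->
  exists h : R -> 'rV[R]_d -> 'M[R[i]]_(N + N),
    (* continuity of the family (jointly in epsilon and k) *)
    (forall (a b : 'I_(N + N)),
       {within [set p : R * 'rV[R]_d | 0 <= p.1 <= 1],
          continuous (fun p => complex.Re (h p.1 p.2 a b))} /\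
       {within [set p : R * 'rV[R]_d | 0 <= p.1 <= 1],
          continuous (fun p => complex.Im (h p.1 p.2 a b))}) /\
    h 0 = bdg_of_H up vp um vm /\
    h 1 = bdg_of_Htilde up um /\
    forall eps : R, 0 <= eps <= 1 ->
      is_quadratic_bdg (h eps) /\
      short_ranged (h eps) /\
      dyn_stable (h eps) /\
      gap_half (h eps).
Proof.
move=> _ _ _ upp umm upm ump pvp mvm pvm mvp
  sQp sTp sZp sQm sTm sZm pQp pTp pZp pQm pTm pZm.
pose Q k := graded_gram (up k) (up k) (um k) (um k).
pose T k := graded_gram (vp k) (vp k) (vm k) (vm k).
pose Z k := graded_gram (up k) (vp k) (um k) (vm k).
have [sQ sT sZ] : [/\ smooth_mxfun Q, smooth_mxfun T & smooth_mxfun Z].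
  by split; exact: smooth_mxfunB.
have [pQ pT pZ] : [/\ periodic_mxfun Q, periodic_mxfun T & periodic_mxfun Z].
  by split; exact: periodic_mxfunB.
(* The path shrinks [v] to [(1 - eps) v] with [u] fixed. This need not preserve the bosonic
   normalization, but it ends at the number-conserving block-diagonal matrix. *)
pose h (eps : R) k :=
  bdg_block (1 - eps) (Q k) (Q (- k)) (T k) (T (- k)) (Z k) (Z (- k)).
have spectrum eps k : 0 <= eps <= 1 -> diagonalizable (dynmx (h eps k)) /\
    forall w, eigenvalue (dynmx (h eps k)) w -> w \is Num.real /\ (w = 0 \/ 1 <= `|w|).
  move=> /andP[e0 e1]; apply: bdg_block_spectrum; last first.
  - by rewrite subr_ge0 e1 lerBlDr lerDl.
  (* Stacking the two species merges the sector-wise constraints into single block identities; the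
     normalization is used at both [k] and [- k]. *)
  - rewrite !tr_col_mx !mul_col_row opp_block_mx add_block_mx.
    by rewrite pvp mvm pvm mvp block_mx0.
  - rewrite !adjmx_col !mul_col_row opp_block_mx add_block_mx.
    by rewrite upp umm upm ump -scalar_mx_block.
  - rewrite !adjmx_col !mul_col_row opp_block_mx add_block_mx.
    by rewrite upp umm upm ump -scalar_mx_block.
exists h; split=> [a b|].
  have cid : continuous (snd : R * 'rV[R]_d -> 'rV[R]_d) by move=> p; exact: cvg_snd.
  have cN : continuous (fun p : R * 'rV[R]_d => - p.2).
    by move=> p; exact: (cvgN (cid p)).
  have ce : continuous (fun p : R * 'rV[R]_d => 1 - p.1).
    have cf : continuous (fst : R * 'rV[R]_d -> R) by move=> p; exact: cvg_fst.
    by move=> p; exact: (cvgB (cvg_cst (1 : R)) (cf p)).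
  have : entrywise (fun f : R * 'rV[R]_d -> R => continuous f)
      (fun p => h p.1 p.2).
    apply: entrywise_bdg_block.
    - by move=> f g cf cg p; exact: (cvgD (cf p) (cg p)).
    - by move=> f cf p; exact: (cvgN (cf p)).
    - by move=> f cf p; exact: (cvgM (ce p) (cf p)).
    - exact: (smooth_mxfun_continuous sQ cid).
    - exact: (smooth_mxfun_continuous sQ cN).
    - exact: (smooth_mxfun_continuous sT cid).
    - exact: (smooth_mxfun_continuous sT cN).
    - exact: (smooth_mxfun_continuous sZ cid).
    - exact: (smooth_mxfun_continuous sZ cN).
  by move=> /(_ a b)[cr ci]; split; exact: continuous_subspaceT.
split.
  have scale1 n (v : 'rV[R]_d -> 'M[R[i]]_(n, N)) :
      (fun k => (1 : R)%:C%C *: v k) = v.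
    by apply/funext => k; rewrite scale1r.
  apply/funext => k; rewrite /h subr0.
  by have /esym := bdg_of_HE 1 up vp um vm k; rewrite !scale1.
split; first by apply/funext => k; rewrite /h subrr bdg_block0.
move=> eps eps01.
split; [split | split; [|split]].
- move=> k j; rewrite /h (periodic_mxfun_opp k j pQ) (periodic_mxfun_opp k j pT).
  by rewrite (periodic_mxfun_opp k j pZ) (pQ k j) (pT k j) (pZ k j).
- move=> k; split; first by apply: bdg_block_hermitian; exact: adjmx_graded_gram.
  by rewrite /h opprK bdg_block_particle_hole.
- apply: (@entrywise_bdg_block _ _ (@smooth_rfun R d)).
  + exact: smooth_rfunD.
  + exact: smooth_rfunN.
  + exact: smooth_rfunZ.
  + exact: sQ.
  + exact: (smooth_mxfun_compN sQ).
  + exact: sT.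
  + exact: (smooth_mxfun_compN sT).
  + exact: sZ.
  + exact: (smooth_mxfun_compN sZ).
- by move=> k; have [diag spec] := spectrum _ k eps01; split=> // w /spec[].
(* The width is uniform in [k] and [eps], as the spectrum stays in [0] and [|w| >= 1]. *)
- exists 2^-1; split; first by rewrite invr_gt0.
  move=> k w ew; have [_ /(_ w ew)[_ wE]] := spectrum _ k eps01.
  have half : `|2^-1 : R[i]| = 2^-1 by rewrite ger0_norm ?invr_ge0.
  split; first exact: gap_half_norm.
  by rewrite -[X in w + X]opprK; apply: gap_half_norm; rewrite ?normrN.
Qed.
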